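(* Let $(X,Y)$ be a random pair with joint distribution $\pi$ on $\mathbb{R}^d\times[k]$, let $g:\mathbb{R}^d\to\Delta^{k-1}$ be a predictor, and let $c(X)=\operatorname{argmax}_i g^i(X)$ and $h(X)=\max_i g^i(X)$. Let $\phi:\Delta^{k-1}\to\overline{\mathbb{R}}$ and $\varphi:[0,1]\to\overline{\mathbb{R}}$ be any $C^1$, convex functions whose Bregman divergences satisfy $d_{\phi}(x,y)\ge d_{\varphi}(x_i,y_i)$ for all $x,y\in\Delta^{k-1}$ and all $i\in[k]$. Then, with probability 1, $$\mathbb{E}\big[d_{\phi}(\mathbb{E}[\pi_{Y\mid X}\mid g(X)],\,g(X))\,\big|\,h(X)\big]\;\ge\; d_{\varphi}\big(\mathbb{E}[\mathbf{1}_{Y=c(X)}\mid h(X)],\,h(X)\big).$$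
   Context: $[k]=\{1,\dots,k\}$; $\Delta^{k-1}\subset\mathbb{R}^k$ is the probability simplex; $\overline{\mathbb{R}}$ is the extended real line. $\pi_{Y\mid X}$ is the regular conditional distribution of $Y$ given $X$, identified with a $\Delta^{k-1}$-valued random vector (its $i$-th coordinate is $\mathbb{P}(Y=i\mid X)$). $g$ is measurable and $g^i$ denotes its $i$-th coordinate. Ties in the argmax are broken by an arbitrary fixed (measurable) rule depending only on $g(X)$, so $c(X)$ is a function of $g(X)$. For a $C^1$ convex function $\psi$, the Bregman divergence is $d_\psi(x,y)=\psi(x)-\psi(y)-\nabla\psi(y)^\top(x-y)$ (with $\nabla\psi=\psi'$ in one dimension). *)

(* Defs.v *)
From HB Require Import structures.
From mathcomp Require Import all_boot all_order all_algebra.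
From mathcomp Require Import all_classical all_reals all_analysis.
From mathcomp Require Import measurable_realfun.
Set Implicit Arguments.
Unset Strict Implicit.
Unset Printing Implicit Defensive.
Import Order.TTheory GRing.Theory Num.Theory.
Import numFieldNormedType.Exports.
Local Open Scope classical_set_scope.
Local Open Scope ring_scope.

(* R^n with its Borel sigma-algebra (convertible to 'rV[R]_n) *)
Notation borel_rV R n := (g_sigma_algebraType (@open 'rV[R]_n)).

Definition simplex (R : realType) (k : nat) : set 'rV[R]_k :=
  [set x | (forall i, 0 <= x ord0 i) /\ \sum_(i < k) x ord0 i = 1].

(* The default value 0 is harmless for vectors with nonnegative coordinates,
   in particular on the simplex. *)
Definition max_coord (R : realType) (k : nat) (x : 'rV[R]_k) : R :=
  \big[Num.max/0]_(i < k) x ord0 i.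

(* A measurable selection of the argmax on the simplex, that is, a tie-breaking
   rule which only looks at the vector of scores. *)
Definition is_argmax_rule (R : realType) (k : nat) (am : 'rV[R]_k -> 'I_k) :=
  (forall x, simplex x -> forall j, x ord0 j <= x ord0 (am x)) /\
  (forall i, (measurable : set (set (borel_rV R k)))
               (@simplex R k `&` am @^-1` [set i])).

(* V is a version of E[U | Z], i.e. of the conditional expectation of U given
   the sigma-algebra generated by Z.  Meaningful when U is measurable, and
   integrable or almost surely nonnegative (possibly with value +oo). *)
Definition is_condexp d (T : measurableType d) (R : realType)
    (P : probability T R) (U : T -> \bar R)
    d' (S : measurableType d') (Z : T -> S) (V : T -> \bar R) : Prop :=
  (forall B : set (\bar R), measurable B -> g_sigma_algebra_preimage Z (V @^-1` B)) /\
  (forall A, g_sigma_algebra_preimage Z A ->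
     (\int[P]_(w in A) V w = \int[P]_(w in A) U w)%E).

Section bregman.
Context {R : realType} {V : normedModType R}.
Implicit Types (C : set V) (psi : V -> \bar R) (dpsi : V -> V -> \bar R).

(* The inequality is required whenever its right-hand side is not of the form
   oo - oo. *)
Definition econvex_on C psi : Prop :=
  forall x y (t : R), C x -> C y -> 0 <= t <= 1 ->
    (t%:E * psi x +? (1 - t)%R%:E * psi y)%E ->
    (psi (t *: x + (1 - t) *: y)%R <= t%:E * psi x + (1 - t)%R%:E * psi y)%E.

Definition edom C psi : set V := [set y | C y /\ psi y \is a fin_num].

(* [dpsi y v] stands for the pairing of the gradient of psi at y with v.  Since
   C may have an empty interior or contain boundary points, the gradient is
   specified by the one-sided derivatives of psi at y towards the points of C;
   these may be infinite (as for the entropy at the boundary of the simplex). *)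
Definition is_gradient_on C psi dpsi : Prop :=
  forall x y, C x -> edom C psi y ->
    ((psi (y + t *: (x - y))%R - psi y) * (t^-1)%:E)%E @[t --> (0 : R)^'+]
      --> dpsi y (x - y).

(* The usual convention: the divergence is +oo when the formula makes no sense,
   that is, outside C or when psi y is infinite. *)
Definition bregman C psi dpsi (x y : V) : \bar R :=
  if `[< C x /\ edom C psi y >] then (psi x - psi y - dpsi y (x - y)%R)%E
  else +oo%E.

End bregman.

Section simplex_functions.
Context {R : realType} {k : nat}.
Implicit Types (phi : 'rV[R]_k -> \bar R) (grad : 'rV[R]_k -> 'I_k -> \bar R).

(* grad(y)^T v, with 0 * oo = 0 *)
Definition edot grad (y v : 'rV[R]_k) : \bar R :=
  (\sum_(i < k) grad y i * (v ord0 i)%:E)%E.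

(* phi is continuously differentiable on the simplex with gradient grad; both
   may take infinite values.  On the simplex the gradient is only determined up
   to a multiple of the all-one vector, and the divergence does not depend on
   this choice. *)
Definition C1_on_simplex phi grad : Prop :=
  [/\ {within @simplex R k, continuous phi},
      forall i, {within edom (@simplex R k) phi, continuous (grad ^~ i)} &
      is_gradient_on (@simplex R k) phi (edot grad)].

Definition bregman_simplex phi grad (x y : 'rV[R]_k) : \bar R :=
  bregman (@simplex R k) phi (edot grad) x y.

End simplex_functions.

Section unit_interval_functions.
Context {R : realType}.
Implicit Types (phi dphi : R^o -> \bar R).

Definition unit_itv : set R^o := `[0, 1].

Definition emul dphi (y v : R^o) : \bar R := (dphi y * v%:E)%E.

Definition C1_on_unit_itv phi dphi : Prop :=
  [/\ {within unit_itv, continuous phi},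
      {within edom unit_itv phi, continuous dphi} &
      is_gradient_on unit_itv phi (emul dphi)].

Definition bregman_unit_itv phi dphi (x y : R^o) : \bar R :=
  bregman unit_itv phi (emul dphi) x y.

End unit_interval_functions.

(* Main.v *)
(* Write G(x, y) = d_varphi(x, y), h = h(X), c = c(X) and p_c for the
   coordinate of p = E[pi_{Y|X} | g(X)] of index c.  Domination gives
   d_phi(p, g(X)) >= G(p_c, h), and E[p_c | h] = E[1_{Y = c} | h] = q, so the
   claim is a conditional Jensen inequality for the random convex function
   G(., h).  Where D < G(q, h), a line with rational coefficients lies below
   G(., h) on [0, 1] while still exceeding D at q by a rational margin, say
   D <= r < r' <= a q + b.  For each of the countably many choices of
   (a, b, r, r'), the set A where this happens is in the sigma-algebra of h, so
   r' P(A) <= E[(a q + b) 1_A] = E[(a p_c + b) 1_A]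
           <= E[d_phi(p, g(X)) 1_A] = E[D 1_A] <= r P(A),
   whence P(A) = 0. *)
Require Import Defs.
From mathcomp Require Import all_boot all_order all_algebra.
From mathcomp Require Import all_classical all_reals all_analysis.
From mathcomp Require Import measurable_realfun.
From mathcomp Require Import ring lra.
Import Order.TTheory GRing.Theory Num.Theory.
Import numFieldNormedType.Exports.
Local Open Scope classical_set_scope.
Local Open Scope ring_scope.

Set Implicit Arguments.
Unset Strict Implicit.
Unset Printing Implicit Defensive.

(** * Lines below a convex function on the real line *)

(* q need not belong to I: this spares a proof that q is almost surely in
   [0, 1]. *)
Lemma separating_slope (R : realType) (I : set R) (f : R -> \bar R)
    (q m : R) :
  0 <= m ->
  (forall x, I x -> (0 <= f x)%E) ->
  (\forall x \near q, I x -> (m%:E < f x)%E) ->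
  (forall x1 x2 v1 v2, I x1 -> I x2 -> x1 < q -> q < x2 ->
    (f x1 <= v1%:E)%E -> (f x2 <= v2%:E)%E ->
    m * (x2 - x1) <= (x2 - q) * v1 + (q - x1) * v2) ->
  exists s, forall x, I x -> ((m + s * (x - q))%:E <= f x)%E.
Proof.
move=> m0 f0 /nbhs_ballP[e /= e0 qe] fconv.
have flsc x : I x -> `|x - q| < e -> (m%:E < f x)%E.
  by move=> Ix xq; apply: qe => //; rewrite /ball/= distrC.
(* The quotients are slopes of chords from epigraph points left of [q] up to [(q, m)]; the sought
   slope must be at least all of them. The value [- (m / e)] keeps [L] nonempty when there are no
   such points. *)
pose L := [set s : R | s = - (m / e) \/
  exists x v, [/\ I x, x < q, (f x <= v%:E)%E & s = (m - v) / (q - x)]].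
have ge0 x v : I x -> (f x <= v%:E)%E -> 0 <= v.
  by move=> Ix fxv; rewrite -lee_fin (le_trans (f0 _ Ix)).
(* Closer to [q] than [e], [m < v] makes the quotient negative; farther away, the rise is at most
   [m], since [0 <= v], over a run of at least [e]. *)
have steep x v : I x -> (f x <= v%:E)%E -> 0 < `|x - q| ->
    (m - v) / `|x - q| <= m / e.
  move=> Ix fxv xq; rewrite ler_pdivrMr//.
  have me : 0 <= m / e by rewrite divr_ge0// ltW.
  have [xe|ex] := ltP `|x - q| e.
    have := lt_le_trans (flsc _ Ix xe) fxv; rewrite lte_fin => mv.
    by rewrite (@le_trans _ _ 0) ?subr_le0 ?(ltW mv)// mulr_ge0.
  rewrite (@le_trans _ _ m)//; first by rewrite lerBlDr lerDl (ge0 x).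
  rewrite -{1}[m](@divfK _ e) ?gt_eqF//.
  by rewrite ler_wpM2l.
(* Chords to the right of [q] dominate [L]: [steep] handles [- (m / e)], and [fconv] compares a left
   chord with a right one. Hence [sup L] separates the two families. *)
have ubL x v : I x -> q < x -> (f x <= v%:E)%E -> ubound L ((v - m) / (x - q)).
  move=> Ix qx fxv; have xq : 0 < x - q by rewrite subr_gt0.
  move=> _ [->|[y [w [Iy yq fyw ->]]]].
    rewrite lerNl -mulNr opprB.
    by have := steep _ _ Ix fxv; rewrite gtr0_norm//; apply.
  have qy : 0 < q - y by rewrite subr_gt0.
  rewrite ler_pdivrMr// mulrAC ler_pdivlMr//.
  have := fconv _ _ _ _ Iy Ix yq qx fyw fxv; lra.
have hsL : has_sup L.
  split; first by exists (- (m / e)); left.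
  exists (m / e) => _ [->|[y [w [Iy yq fyw ->]]]].
    by rewrite ge0_cp// divr_ge0// ltW.
  have qy : 0 < q - y by rewrite subr_gt0.
  by have := steep _ _ Iy fyw; rewrite distrC gtr0_norm//; apply.
exists (sup L) => x Ix; case fx : (f x) => [v| |]; last 2 first.
- by rewrite leey.
- by have := f0 _ Ix; rewrite fx.
have fxv : (f x <= v%:E)%E by rewrite fx.
rewrite lee_fin; have [xq|qx|xq] := ltgtP x q.
- have : (m - v) / (q - x) <= sup L.
    by apply: ub_le_sup; [exact: hsL.2|right; exists x, v].
  rewrite ler_pdivrMr ?subr_gt0//; lra.
- have : sup L <= (v - m) / (x - q).
    by apply: ge_sup; [exact: hsL.1|exact: ubL].
  rewrite ler_pdivlMr ?subr_gt0//; lra.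
- have : (m%:E < f x)%E by apply: flsc => //; rewrite xq subrr normr0.
  by rewrite fx lte_fin xq subrr mulr0 addr0 => /ltW.
Qed.

(** Choosing [a] just below [s] can only lower the line on [0 <= x], once [b] is below [m - s * q].
    The tolerance [e] makes [(s - a) * q] smaller than [m - c], which leaves room for a rational [b]
    that keeps the value at [q] above [c]. *)
Lemma rational_line_below (R : realType) (q m d s : R) : d < m ->
  exists a b r r' : rat, [/\ ratr r < ratr r' :> R, d <= ratr r,
    ratr r' <= ratr a * q + ratr b &
    forall x, 0 <= x <= 1 -> ratr a * x + ratr b <= m + s * (x - q)].
Proof.
move=> dm; pose c := (m + d) / 2.
have cm : c < m by rewrite /c; lra.
have [r] : exists r, ratr r \in `]d, c[ by apply: rat_in_itvoo; rewrite /c; lra.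
rewrite in_itv/= => /andP[dr rc].
have [r'] := rat_in_itvoo rc.
rewrite in_itv/= => /andP[rr' r'c].
pose e := (m - c) / (`|q| + 1).
have q1 : 0 < `|q| + 1 by rewrite ltr_wpDl.
have e0 : 0 < e by rewrite divr_gt0// subr_gt0.
have [a] : exists a, ratr a \in `]s - e, s[.
  by apply: rat_in_itvoo; rewrite ltrBlDr ltrDl.
rewrite in_itv/= => /andP[ea as_].
have [b] : exists b, ratr b \in `](c - ratr a * q), (m - s * q)[.
  apply: rat_in_itvoo.
  suff : (s - ratr a) * q < m - c by lra.
  apply: (@le_lt_trans _ _ (e * `|q|)).
    rewrite (@le_trans _ _ ((s - ratr a) * `|q|))//.
      by rewrite ler_wpM2l ?ler_norm// subr_ge0 ltW.
    by rewrite ler_wpM2r// lerBlDl -lerBlDr ltW.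
  by rewrite /e mulrAC ltr_pdivrMr// ltr_pM2l ?subr_gt0// ltrDl.
rewrite in_itv/= => /andP[cb bm].
exists a, b, r, r'; split => //; [exact: ltW|lra|].
move=> x /andP[x0 _].
have : ratr a * x <= s * x by rewrite ler_wpM2r// ltW.
lra.
Qed.

(** * Limits in the extended reals *)

Lemma cvge_near_lt (T : Type) (F : set_system T) (R : realFieldType)
    (f : T -> \bar R) (l c : \bar R) :
  f x @[x --> F] --> l -> (l < c)%E -> \forall x \near F, (f x < c)%E.
Proof.
move=> fl lc; apply: (fl [set z | (z < c)%E]).
by apply: open_nbhs_nbhs; split => //; exact: open_ereal_lt_ereal.
Qed.

Lemma cvge_near_gt (T : Type) (F : set_system T) (R : realFieldType)
    (f : T -> \bar R) (l c : \bar R) :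
  f x @[x --> F] --> l -> (c < l)%E -> \forall x \near F, (c < f x)%E.
Proof.
move=> fl lc; apply: (fl [set z | (c < z)%E]).
by apply: open_nbhs_nbhs; split => //; exact: open_ereal_gt_ereal.
Qed.

Lemma cvge_near_fin_num (T : Type) (F : set_system T) {FF : Filter F}
    (R : realFieldType) (f : T -> \bar R) (l : \bar R) :
  f x @[x --> F] --> l -> l \is a fin_num ->
  \forall x \near F, f x \is a fin_num.
Proof.
move=> fl lfin; near=> x; rewrite fin_numElt; apply/andP; split.
- by near: x; apply: (cvge_near_gt fl); rewrite ltNye_eq lfin.
- by near: x; apply: (cvge_near_lt fl); rewrite ltey_eq lfin.
Unshelve. all: by end_near. Qed.

(** * Bregman divergences on the unit interval *)

Section interval_bregman.
Context {R : realType}.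
Implicit Types (psi dpsi : R^o -> \bar R) (x y q : R^o).
Local Notation I := (@unit_itv R).

Lemma unit_itvP x : I x <-> 0 <= x <= 1.
Proof. by rewrite /unit_itv /= in_itv. Qed.

Lemma near_segment x y (Q : set R^o) : I x -> I y ->
  (\forall z \near within I (nbhs y), Q z) ->
  \forall t \near (0 : R)^'+,
    [/\ 0 < t, t < 1, I (y + t *: (x - y)) & Q (y + t *: (x - y))].
Proof.
move=> /unit_itvP Ix /unit_itvP Iy; rewrite near_withinE => nQ.
have seg : (y + t *: (x - y) : R^o) @[t --> (0 : R)^'+] --> y.
  apply: cvg_at_right_filter.
  rewrite -[X in _ --> X]addr0 -[X in _ --> _ + X](scale0r (x - y)).
  by apply: cvgD; [exact: cvg_cst|apply: cvgZr_tmp; exact: cvg_id].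
have {}nQ := seg _ nQ.
near=> t.
have t0 : 0 < t by near: t; exact: nbhs_right_gt.
have t1 : t < 1 by near: t; exact: nbhs_right_lt.
have It : I (y + t *: (x - y)).
  apply/unit_itvP; rewrite /GRing.scale/=.
  have := mulr_ge0 (ltW t0) (proj1 (andP Ix)).
  have := mulr_ge0 (ltW t0) (proj1 (andP Iy)); nra.
split => //; move: It; near: t; exact: nQ.
Unshelve. all: by end_near. Qed.

Lemma C1_cvg psi dpsi y : C1_on_unit_itv psi dpsi -> I y ->
  psi z @[z --> within I (nbhs y)] --> psi y.
Proof. by move=> [/subspace_continuousP cpsi _ _]; exact: cpsi. Qed.

Lemma near_edom psi dpsi y : C1_on_unit_itv psi dpsi -> edom I psi y ->
  \forall z \near within I (nbhs y), edom I psi z.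
Proof.
move=> psiC1 [Iy fy].
near=> z; split; near: z; first exact: withinT.
exact: cvge_near_fin_num (C1_cvg psiC1 Iy) fy.
Unshelve. all: by end_near. Qed.

(** By convexity a value [-oo] at [x] would spread to the open segment between [x] and [y], whereas
    continuity keeps [psi] finite near [y]. *)
Lemma convex_gt_ninfty psi dpsi x y : C1_on_unit_itv psi dpsi ->
  econvex_on I psi -> edom I psi y -> I x -> (-oo < psi x)%E.
Proof.
move=> psiC1 cpsi ey Ix; rewrite ltNye; apply/eqP => psix.
have [t [t0 t1 _ [_]]] := filter_ex (near_segment Ix ey.1 (near_edom psiC1 ey)).
have -> : y + t *: (x - y) = t *: x + (1 - t) *: y.
  by rewrite /GRing.scale/=; ring.
have t01 : 0 <= t <= 1 by rewrite !ltW.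
have := cpsi _ _ _ Ix ey.1 t01; rewrite psix gt0_muleNy ?lte_fin//.
have -> : (-oo + (1 - t)%:E * psi y = -oo)%E by [].
rewrite leeNy_eq => H /fin_numP[]; rewrite (eqP (H _))//.
by rewrite -(fineK ey.2) -EFinM.
Qed.

(** Convexity bounds every difference quotient by [psi x - psi y], and the bound survives the
    limit. *)
Lemma tangent_le psi dpsi x y : C1_on_unit_itv psi dpsi ->
  econvex_on I psi -> edom I psi y -> I x ->
  (emul dpsi y (x - y)%R <= psi x - psi y)%E.
Proof.
move=> psiC1 cpsi ey Ix; have [_ _ /(_ _ _ Ix ey) slope] := psiC1.
have := convex_gt_ninfty psiC1 cpsi ey Ix.
case psix : (psi x) => [u| |] // _; last first.
  by rewrite -(fineK ey.2) leey.
apply: (cvge_le _ slope).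
have := near_segment Ix ey.1 (near_edom psiC1 ey).
apply: filterS => t [t0 t1 _ [_]].
have -> : y + t *: (x - y) = t *: x + (1 - t) *: y.
  by rewrite /GRing.scale/=; ring.
move=> zfin; have t01 : 0 <= t <= 1 by rewrite !ltW.
have := cpsi _ _ _ Ix ey.1 t01; rewrite psix -(fineK ey.2) -(fineK zfin).
move=> /(_ isT); rewrite -!EFinM -!EFinD !lee_fin => le_psi.
by rewrite ler_pdivrMr//; lra.
Qed.

(** Since [psi x] may be [+oo], the tangent bound is applied at a point of the segment near [y],
    where [psi] is finite; positive homogeneity of the pairing then reaches [x]. *)
Lemma emul_lt_pinfty psi dpsi x y : C1_on_unit_itv psi dpsi ->
  econvex_on I psi -> edom I psi y -> I x ->
  (emul dpsi y (x - y)%R < +oo)%E.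
Proof.
move=> psiC1 cpsi ey Ix.
have [t [t0 t1 Iz [_ zfin]]] :=
  filter_ex (near_segment Ix ey.1 (near_edom psiC1 ey)).
have := tangent_le psiC1 cpsi ey Iz.
rewrite -(fineK ey.2) -(fineK zfin) addrAC subrr add0r.
move=> H; rewrite ltey; apply/eqP => E; move: H.
rewrite /emul /GRing.scale/= mulrC EFinM muleA -/(emul dpsi y (x - y)) E.
by rewrite gt0_mulye ?lte_fin// leye_eq.
Qed.

Lemma bregman_ge0 psi dpsi x y : C1_on_unit_itv psi dpsi ->
  econvex_on I psi -> (0 <= bregman_unit_itv psi dpsi x y)%E.
Proof.
move=> psiC1 cpsi; rewrite /bregman_unit_itv /bregman.
case: asboolP => [[Ix ey]|_]; last exact: leey.
have := tangent_le psiC1 cpsi ey Ix.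
have := convex_gt_ninfty psiC1 cpsi ey Ix.
have := emul_lt_pinfty psiC1 cpsi ey Ix.
rewrite -(fineK ey.2); case: (emul _ _ _) => [e| |] // _.
- case: (psi x) => [u| |] // _; last by move=> _; exact: leey.
  by rewrite -!EFinB !lee_fin subr_ge0.
- by case: (psi x) => [u| |] // _ _; exact: leey.
Qed.

Lemma bregman_fin_slope psi dpsi x y : edom I psi y ->
  dpsi y \is a fin_num -> I x ->
  bregman_unit_itv psi dpsi x y =
  (psi x - (fine (psi y) + fine (dpsi y) * (x - y))%:E)%E.
Proof.
move=> ey dy Ix; rewrite /bregman_unit_itv /bregman asboolT//.
rewrite /emul -{1}(fineK ey.2) -{1}(fineK dy) -EFinM.
by rewrite EFinD fin_num_oppeD// addeA.
Qed.

(** Off the diagonal the pairing is infinite and not [+oo], hence [-oo]; on the diagonal it vanishes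
    because [0 * oo = 0]. *)
Lemma bregman_infinite_slope psi dpsi x y : C1_on_unit_itv psi dpsi ->
  econvex_on I psi -> edom I psi y -> dpsi y \isn't a fin_num -> I x ->
  bregman_unit_itv psi dpsi x y = if x == y then 0%E else +oo%E.
Proof.
move=> psiC1 cpsi ey dy Ix; rewrite /bregman_unit_itv /bregman asboolT//.
case: eqVneq => [->|xy].
  by rewrite /emul subrr mule0 sube0 subee// ey.2.
have := convex_gt_ninfty psiC1 cpsi ey Ix.
have := emul_lt_pinfty psiC1 cpsi ey Ix.
have : emul dpsi y (x - y) \isn't a fin_num.
  rewrite /emul; move: dy; rewrite !fin_numE !negb_and !negbK.
  have : x - y != 0 by rewrite subr_eq0.
  rewrite neq_lt => /orP[] xy0 /orP[] /eqP ->.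
  - by rewrite lt0_mulNye ?lte_fin.
  - by rewrite lt0_mulye ?lte_fin// orbT.
  - by rewrite gt0_mulNye ?lte_fin// orbT.
  - by rewrite gt0_mulye ?lte_fin// orbT.
rewrite -(fineK ey.2); case: (emul _ _ _) => [e| |] // _.
by case: (psi x).
Qed.

Lemma bregman_out psi dpsi x y : ~ edom I psi y ->
  bregman_unit_itv psi dpsi x y = +oo%E.
Proof.
by move=> ey; rewrite /bregman_unit_itv /bregman asboolF// => -[].
Qed.

Lemma near_notin_unit_itv q : ~ I q -> \forall x \near q, ~ I x.
Proof.
move=> nIq; apply: open_nbhs_nbhs; split => //.
apply: closed_openC; exact: itv_closed.
Qed.

(** For a finite slope the divergence is [psi] minus a finite affine function, hence continuous in
    its first argument. For an infinite slope, [0 <= m] forces [q != y], and the divergence is [+oo]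
    at all points of the interval near [q]. *)
Lemma bregman_lsc psi dpsi q y (m : R) : C1_on_unit_itv psi dpsi ->
  econvex_on I psi -> 0 <= m -> (m%:E < bregman_unit_itv psi dpsi q y)%E ->
  \forall x \near q, I x -> (m%:E < bregman_unit_itv psi dpsi x y)%E.
Proof.
move=> psiC1 cpsi m0 mq.
have [ey|ey] := pselect (edom I psi y); last first.
  by near=> x => Ix; rewrite bregman_out// ltry.
have [Iq|nIq] := pselect (I q); last first.
  by near=> x => Ix; exfalso; move: Ix; near: x; exact: near_notin_unit_itv.
have [dy|dy] := boolP (dpsi y \is a fin_num); last first.
  move: mq; rewrite (bregman_infinite_slope psiC1 cpsi)//.
  case: eqVneq => [_|qy _]; first by rewrite lte_fin ltNge m0.
  near=> x => Ix; rewrite (bregman_infinite_slope psiC1 cpsi)//.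
  rewrite ifF ?ltry//; apply/negbTE; near: x.
  exact: (@open_nbhs_nbhs _ q [set x | x != y]).
pose F x := (psi x - (fine (psi y) + fine (dpsi y) * (x - y))%:E)%E.
suff : \forall x \near within I (nbhs q), (m%:E < F x)%E.
  rewrite near_withinE => mF; near=> x => Ix; rewrite bregman_fin_slope//.
  by move: Ix; near: x.
apply: (@cvge_near_gt _ _ _ _ (F q)); last first.
  by rewrite /F -bregman_fin_slope.
apply: cvgeB; [by rewrite fin_num_adde_defl| exact: C1_cvg psiC1 Iq|].
apply: cvg_EFin; first exact: nearW.
apply: cvg_within_filter; apply: cvgD; first exact: cvg_cst.
by apply: cvgMl_tmp; apply: cvgB; [exact: cvg_id|exact: cvg_cst].
Unshelve. all: by end_near. Qed.

(** A finite bound excludes the conventional value [+oo]. The case [x = y] stays apart because the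
    slope may be infinite there. *)
Lemma bregman_le_fin psi dpsi x y (v : R) : C1_on_unit_itv psi dpsi ->
  econvex_on I psi -> (bregman_unit_itv psi dpsi x y <= v%:E)%E ->
  [/\ I x, edom I psi y & x = y \/ [/\ dpsi y \is a fin_num,
    psi x \is a fin_num & fine (psi x) <=
      v + fine (psi y) + fine (dpsi y) * (x - y)]].
Proof.
move=> psiC1 cpsi bv.
have [ey|ey] := pselect (edom I psi y); last by rewrite bregman_out in bv.
have [Ix|nIx] := pselect (I x); last first.
  by move: bv; rewrite /bregman_unit_itv /bregman asboolF// => -[].
split => //; have [->|xy] := eqVneq x y; [by left|right].
have [dy|dy] := boolP (dpsi y \is a fin_num); last first.
  by move: bv; rewrite (bregman_infinite_slope psiC1 cpsi)// (negbTE xy).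
move: bv; rewrite bregman_fin_slope//.
have := convex_gt_ninfty psiC1 cpsi ey Ix.
case: (psi x) => [u| |]// _; rewrite -EFinB lee_fin /= => uv.
split => //; lra.
Qed.

(** Subtracting an affine function of the first argument preserves the convexity of [psi]. The
    inequality is cleared of denominators to fit [separating_slope]. *)
Lemma bregman_convex psi dpsi q y m x1 x2 (v1 v2 : R) :
  C1_on_unit_itv psi dpsi -> econvex_on I psi ->
  (m%:E < bregman_unit_itv psi dpsi q y)%E -> x1 < q -> q < x2 ->
  (bregman_unit_itv psi dpsi x1 y <= v1%:E)%E ->
  (bregman_unit_itv psi dpsi x2 y <= v2%:E)%E ->
  m * (x2 - x1) <= (x2 - q) * v1 + (q - x1) * v2.
Proof.
move=> psiC1 cpsi mq x1q qx2 b1 b2.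
have [I1 ey c1] := bregman_le_fin psiC1 cpsi b1.
have [I2 _ c2] := bregman_le_fin psiC1 cpsi b2.
have x12 : 0 < x2 - x1 by rewrite subr_gt0 (lt_trans x1q).
(* An infinite slope would give [x1 = y] and [x2 = y]. *)
have dy : dpsi y \is a fin_num.
  case: c1 => [x1y|[]//]; case: c2 => [x2y|[]//].
  by move: x12; rewrite x1y x2y subrr ltxx.
have fin x v : I x -> (bregman_unit_itv psi dpsi x y <= v%:E)%E ->
    psi x \is a fin_num /\
    fine (psi x) <= v + fine (psi y) + fine (dpsi y) * (x - y).
  move=> Ix bxv; have [_ _ [xy|[_ //]]] := bregman_le_fin psiC1 cpsi bxv.
  rewrite xy subrr mulr0 addr0 lerDr; split; first exact: ey.2.
  by rewrite -lee_fin (le_trans _ bxv)// bregman_ge0.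
have [p1 le1] := fin _ _ I1 b1.
have [p2 le2] := fin _ _ I2 b2.
pose t := (x2 - q) / (x2 - x1).
have t0 : 0 <= t by rewrite divr_ge0 ?(ltW x12)// subr_ge0 ltW.
have t1 : 1 - t = (q - x1) / (x2 - x1) by rewrite /t; field; rewrite gt_eqF.
have t1' : 0 <= 1 - t by rewrite t1 divr_ge0 ?(ltW x12)// subr_ge0 ltW.
have qE : q = t *: x1 + (1 - t) *: x2.
  by rewrite t1 /t /GRing.scale/=; field; rewrite gt_eqF.
have Iq : I q.
  move/unit_itvP: I1 => I1; move/unit_itvP: I2 => I2; apply/unit_itvP; lra.
have t01 : 0 <= t <= 1 by lra.
have := cpsi _ _ _ I1 I2 t01; rewrite -(fineK p1) -(fineK p2) -qE => /(_ isT).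
rewrite -!EFinM -EFinD.
move: mq; rewrite bregman_fin_slope//.
have := convex_gt_ninfty psiC1 cpsi ey Iq.
case: (psi q) => [u| |]// _; rewrite -EFinB lte_fin lee_fin.
move=> mu ut.
have tx : t * (x2 - x1) = x2 - q by rewrite divfK// gt_eqF.
have tx' : (1 - t) * (x2 - x1) = q - x1 by rewrite t1 divfK// gt_eqF.
have {}mu : m <= t * fine (psi x1) + (1 - t) * fine (psi x2) -
    (fine (psi y) + fine (dpsi y) * (q - y)) by lra.
have tqE : q - y = t * (x1 - y) + (1 - t) * (x2 - y).
  by rewrite {1}qE /GRing.scale/=; ring.
have {}mu : m <= t * v1 + (1 - t) * v2.
  have h1 := ler_wpM2l t0 le1.
  have h2 := ler_wpM2l t1' le2.
  rewrite tqE in mu.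
  have -> : t * v1 + (1 - t) * v2 =
    t * (v1 + fine (psi y) + fine (dpsi y) * (x1 - y)) +
    (1 - t) * (v2 + fine (psi y) + fine (dpsi y) * (x2 - y)) -
    (fine (psi y) + fine (dpsi y) * (t * (x1 - y) + (1 - t) * (x2 - y))).
    ring.
  lra.
have := ler_wpM2r (ltW x12) mu.
by rewrite mulrDl mulrAC tx mulrAC tx'.
Qed.

Lemma bregman_rational_line psi dpsi q y (D : \bar R) :
  C1_on_unit_itv psi dpsi -> econvex_on I psi ->
  (D < bregman_unit_itv psi dpsi q y)%E ->
  exists a b r r' : rat, [/\ ratr r < ratr r' :> R, (D <= (ratr r)%:E)%E,
    ratr r' <= ratr a * q + ratr b &
    forall x, I x ->
      ((ratr a * x + ratr b)%:E <= bregman_unit_itv psi dpsi x y)%E].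
Proof.
(* For negative [D] the zero line suffices, as the divergence is nonnegative. Otherwise any [m]
   above [D] is nonnegative, as [separating_slope] requires. *)
move=> psiC1 cpsi; have [D0|D0 Dq] := ltP D 0%E.
  move=> _.
  have [d [d0 Dd]] : exists d : R, d < 0 /\ (D <= d%:E)%E.
    case: D D0 => [d| |]//; rewrite ?lte_fin => d0; first by exists d.
    by exists (-1); rewrite leNye; split => //; lra.
  have [r] := rat_in_itvoo d0; rewrite in_itv/= => /andP[dr r0].
  exists 0, 0, r, 0; rewrite !rmorph0 mul0r addr0; split => //.
    by rewrite (le_trans Dd)// lee_fin ltW.
  by move=> x _; rewrite mul0r addr0 bregman_ge0.
have [d DE] : exists d, D = d%:E.
  case: D D0 Dq => [d| |]//; first by exists d.
  by move=> _; rewrite ltNge leey.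
move: D0 Dq; rewrite {}DE lee_fin => d0 dq.
have [m [dm mq]] : exists m, d < m /\ (m%:E < bregman_unit_itv psi dpsi q y)%E.
  case: (bregman_unit_itv _ _ _ _) dq => [v| |] // dv.
    by move: dv; rewrite lte_fin => dv; exists ((d + v) / 2); rewrite lte_fin; lra.
  by exists (d + 1); rewrite ltry; split => //; lra.
have m0 : 0 <= m by lra.
have [s sle] := @separating_slope R I (bregman_unit_itv psi dpsi ^~ y) q m m0
  (fun x _ => bregman_ge0 x y psiC1 cpsi) (bregman_lsc psiC1 cpsi m0 mq)
  (fun x1 x2 v1 v2 _ _ => bregman_convex psiC1 cpsi mq).
have [a [b [r [r' [rr' dr r'q abm]]]]] := rational_line_below q s dm.
exists a, b, r, r'; split => //.
move=> x Ix; by apply: (le_trans _ (sle x Ix)); rewrite lee_fin abm.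
Qed.

Lemma measurable_line_below_bregman psi dpsi (a b : R) :
  C1_on_unit_itv psi dpsi -> econvex_on I psi ->
  measurable [set y : R | I y /\
    forall x, I x -> ((a * x + b)%:E <= bregman_unit_itv psi dpsi x y)%E].
Proof.
move=> psiC1 cpsi.
(* The complement is relatively open in [0, 1], which takes care of the
   uncountable quantification over x. *)
pose O := [set y : R^o | exists2 x : R^o, I x &
  (bregman_unit_itv psi dpsi x y < (a * x + b)%:E)%E].
have mI : measurable (I : set R) by exact: measurable_itv.
suff O_open y : O y -> (O `|` ~` I)° y.
  rewrite (_ : [set y | _] = I `\` (O `|` ~` I)°).
    by apply: measurableD => //; apply: open_measurable; exact: open_interior.
  apply/seteqP; split => y /= [Iy ay]; split => //.
    move=> /interior_subset[[x Ix]|//]; apply/negP.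
    by rewrite -leNgt; exact: ay.
  move=> x Ix; rewrite leNgt; apply/negP => xy.
  by apply: ay; apply: O_open; exists x.
move=> [x Ix xy].
have [_ ey xyP] := bregman_le_fin psiC1 cpsi (ltW xy).
suff : \forall z \near within I (nbhs y), O z.
  rewrite near_withinE /interior; apply: filterS => z zO.
  by have [Iz|nIz] := pselect (I z); [left; exact: zO|right].
have b0 z : edom I psi z -> bregman_unit_itv psi dpsi z z = 0%E.
  move=> ez; rewrite /bregman_unit_itv /bregman asboolT; last by split=> //; exact: ez.1.
  by rewrite /emul subrr mule0 sube0 subee// ez.2.
(* An infinite slope forces [x = y], so the line is positive at [y]. The witness then moves with
   [z]: the divergence of [z] from itself is 0, and the line stays positive by continuity. *)
have [dy|dy] := boolP (dpsi y \is a fin_num); last first.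
  case: xyP dy => [xyE _|[-> //]].
  move: xy; rewrite {}xyE b0// lte_fin => ay.
  near=> z; exists z; first by near: z; exact: withinT.
  rewrite b0; last by near: z; exact: near_edom psiC1 ey.
  rewrite lte_fin; near: z; apply: cvg_within.
  have ab : (a * z + b) @[z --> (y : R)] --> a * y + b.
    apply: cvgD; last exact: cvg_cst.
    by apply: cvgMl_tmp; exact: cvg_id.
  exact: (cvgr_gt _ ab _ ay).
have [_ /subspace_continuousP/(_ _ ey) cdpsi _] := psiC1.
have px : psi x \is a fin_num by case: xyP => [->|[]//]; exact: ey.2.
(* For a finite slope the same [x] remains a witness, because [F] is continuous at [y] within the
   domain of [psi]. *)
pose F z := (psi x - psi z - dpsi z * (x - z)%:E)%E.
have cF : F z @[z --> within (edom I psi) (nbhs y)] --> F y.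
  apply: cvgeB.
  - by apply: fin_num_adde_defr; rewrite fin_numB px ey.2.
  - apply: cvgeB; [exact: fin_num_adde_defr|exact: cvg_cst|].
    apply: cvg_trans (C1_cvg psiC1 ey.1); apply: cvg_app => P nP.
    by apply: (@filterS _ (nbhs y) _ _ _ _ nP) => z Pz -[Iz _]; exact: Pz.
  apply: cvgeM; [by rewrite mule_def_fin|exact: cdpsi|].
  apply: cvg_EFin; first exact: nearW.
  apply: cvg_within_filter.
  by apply: cvgB; [exact: cvg_cst|exact: cvg_id].
have bF z : edom I psi z -> bregman_unit_itv psi dpsi x z = F z.
  by move=> ez; rewrite /bregman_unit_itv /bregman asboolT.
rewrite bF// in xy.
have nF : \forall z \near within I (nbhs y),
    edom I psi z -> (F z < (a * x + b)%:E)%E.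
  by apply: (@cvg_within _ (nbhs y) _ I); exact: cvge_near_lt cF xy.
near=> z; have ez : edom I psi z by near: z; exact: near_edom psiC1 ey.
by exists x => //; rewrite bF//; move: ez; near: z.
Unshelve. all: by end_near. Qed.

End interval_bregman.

(** * Integrals, generated sigma-algebras and measurability of coordinates *)

(* No measurability is assumed: the integral of a nonnegative function is a
   supremum over the simple functions below it.  This matters because
   d_phi(p, g(X)) is not known to be measurable. *)
Lemma integral_le_pointwise d (T : measurableType d) (R : realType)
    (mu : {measure set T -> \bar R}) (A : set T) (f g : T -> \bar R) :
  (forall w, A w -> (f w <= g w)%E) ->
  (\int[mu]_(w in A) f w <= \int[mu]_(w in A) g w)%E.
Proof.
move=> fg.
have fgA w : ((f \_ A) w <= (g \_ A) w)%E.
  by rewrite !patchE; case: ifPn => // /set_mem; exact: fg.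
rewrite /integral; apply: leeB; apply: ereal_sup_le => _ [h /= hf <-];
  exists h => //= w; apply: (le_trans (hf w)).
- by rewrite !funeposE ge_max !le_max fgA lexx orbT.
- by rewrite !funenegE ge_max !le_max leeN2 fgA lexx orbT.
Qed.

Lemma g_sigma_algebra_preimageI d (T : measurableType d)
    d' (S : measurableType d') (Z : T -> S) (A B : set T) :
  g_sigma_algebra_preimage Z A -> g_sigma_algebra_preimage Z B ->
  g_sigma_algebra_preimage Z (A `&` B).
Proof.
move=> [A' mA' <-] [B' mB' <-]; exists (A' `&` B'); first exact: measurableI.
by rewrite preimage_setI !setTI.
Qed.

Lemma g_sigma_algebra_preimage_comp d (T : measurableType d)
    d1 (S1 : measurableType d1) d2 (S2 : measurableType d2)
    (Z : T -> S1) (f : S1 -> S2) (A : set T) :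
  measurable_fun setT f -> g_sigma_algebra_preimage (f \o Z) A ->
  g_sigma_algebra_preimage Z A.
Proof.
move=> mf [B mB <-]; exists (f @^-1` B); last by rewrite !setTI comp_preimage.
by rewrite -[_ @^-1` _]setTI; exact: mf.
Qed.

Lemma g_sigma_algebra_preimage_measurable d (T : measurableType d)
    d' (S : measurableType d') (Z : T -> S) (A : set T) :
  measurable_fun setT Z -> g_sigma_algebra_preimage Z A -> measurable A.
Proof. by move=> mZ [B mB <-]; exact: mZ. Qed.

Lemma measurable_coord (R : realType) (k : nat) (i : 'I_k) :
  measurable_fun setT (fun x : borel_rV R k => (x : 'rV[R]_k) ord0 i).
Proof.
apply: (measurability _ (RGenOInfty.measurableE R)) => //.
move=> _ [_ [x ->] <-]; rewrite setTI; apply: sub_sigma_algebra.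
have := @coord_continuous R 1 k ord0 i.
by move/continuousP; apply; exact: rray_open.
Qed.

Lemma measurable_max_coord (R : realType) (k : nat) :
  measurable_fun setT (fun x : borel_rV R k => max_coord (x : 'rV[R]_k)).
Proof.
rewrite /max_coord; elim: (index_enum _) => [|i s IH].
  by under eq_fun do rewrite big_nil; exact: measurable_cst.
under eq_fun do rewrite big_cons.
by apply: measurable_maxr => //; exact: measurable_coord.
Qed.

Lemma simplex_coord_itv (R : realType) (k : nat) (x : 'rV[R]_k) (i : 'I_k) :
  simplex x -> 0 <= x ord0 i <= 1.
Proof.
move=> [x0 <-]; rewrite x0 (bigD1 i)//= lerDl; exact: sumr_ge0.
Qed.

Lemma max_coord_argmax (R : realType) (k : nat) (am : 'rV[R]_k -> 'I_k)
    (x : 'rV[R]_k) :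
  is_argmax_rule am -> simplex x -> max_coord x = x ord0 (am x).
Proof.
move=> [ham _] sx; apply/eqP; rewrite eq_le; apply/andP; split.
  by apply: bigmax_le => [|i _]; [exact: sx.1|exact: ham].
by rewrite /max_coord; exact: le_bigmax.
Qed.

(** * Measurability and integrability of conditional expectations *)

Section condexp.
Context d (T : measurableType d) (R : realType) (P : probability T R).

Lemma condexp_measurable (U V : T -> \bar R) d' (S : measurableType d')
    (Z : T -> S) :
  measurable_fun setT Z -> is_condexp P U Z V -> measurable_fun setT V.
Proof.
move=> mZ [mV _] _ B mB; rewrite setTI.
exact: g_sigma_algebra_preimage_measurable (mV _ mB).
Qed.

(** The events where [V] is negative or nonnegative lie in the sigma-algebra of [Z], so [U] controls
    the integral of [V] on each: that of [|V|] is at most 0 on the first and at most 1 on the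
    second. *)
Lemma condexp_integrable (U V : T -> \bar R) d' (S : measurableType d')
    (Z : T -> S) :
  measurable_fun setT Z -> (forall w, 0 <= U w <= 1)%E ->
  is_condexp P U Z V -> P.-integrable setT V.
Proof.
move=> mZ U01 cV; have mV := condexp_measurable mZ cV.
have [sV iV] := cV.
pose N := V @^-1` [set x | (x < 0)%E].
pose N' := V @^-1` [set x | (0 <= x)%E].
have sN : g_sigma_algebra_preimage Z N.
  apply: sV; rewrite (_ : [set x | _] = `]-oo, 0%E[%classic); last by rewrite set_itvE.
  exact: emeasurable_itv.
have sN' : g_sigma_algebra_preimage Z N'.
  apply: sV; rewrite (_ : [set x | _] = `[0%E, +oo[%classic); last by rewrite set_itvE.
  exact: emeasurable_itv.
have mN := g_sigma_algebra_preimage_measurable mZ sN.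
have mN' := g_sigma_algebra_preimage_measurable mZ sN'.
apply/integrableP; split => //.
have -> : [set: T] = N `|` N'.
  by apply/seteqP; split => w // _; rewrite /N /N' /=; case: ltP; [left|right].
rewrite ge0_integral_setU//=; last 2 first.
- by apply: measurableT_comp => //; exact: measurable_funTS.
- by apply/disj_setPS => w []; rewrite /N /N' /= => wN; rewrite leNgt wN.
have : (\int[P]_(w in N) `|V w| <= 0)%E.
  have : (0 <= \int[P]_(w in N) V w)%E.
    by rewrite iV//; apply: integral_ge0 => w _; case/andP: (U01 w).
  rewrite (_ : (\int[P]_(w in N) V w)%E = (\int[P]_(w in N) (- `|V w|))%E).
    by rewrite integral_ge0N// leeNr oppe0.
  by apply: eq_integral => w /set_mem wN; rewrite lte0_abs ?oppeK.
move=> VN; have : (\int[P]_(w in N') `|V w| <= 1)%E.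
  rewrite (_ : (\int[P]_(w in N') `|V w|)%E = (\int[P]_(w in N') V w)%E).
    rewrite iV// (le_trans (integral_le_pointwise (g := cst 1%E) _ _))//.
      by move=> w _; case/andP: (U01 w).
    by rewrite integral_cst// mul1e probability_le1.
  by apply: eq_integral => w /set_mem wN; rewrite gee0_abs.
by move=> /(leeD VN)/le_lt_trans; apply; rewrite add0e ltry.
Qed.
End condexp.

(** * Integrals of a coordinate with random index *)

Section selection.
Context d (T : measurableType d) (R : realType) (P : probability T R).

Lemma selectionE (I : finType) (c : T -> I) (f : I -> T -> \bar R) (w : T) :
  f (c w) w = (\sum_(i : I) (f i \_ (c @^-1` [set i])) w)%E.
Proof.
rewrite (bigD1 (c w))//= big1 ?adde0; last first.
  by move=> i ic; rewrite patchE memNset//= => ci; rewrite ci eqxx in ic.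
by rewrite patchE mem_set.
Qed.

Lemma integrable_restrict (A : set T) (f : T -> \bar R) : measurable A ->
  P.-integrable setT f -> P.-integrable setT (f \_ A).
Proof.
move=> mA intf; apply/(integrable_mkcond (D := A)) => //.
exact: (@integrableS _ _ _ P setT).
Qed.

Lemma integrable_selection (I : finType) (c : T -> I) (f : I -> T -> \bar R) :
  (forall i, measurable (c @^-1` [set i])) ->
  (forall i, P.-integrable setT (f i)) ->
  P.-integrable setT (fun w => f (c w) w).
Proof.
move=> mc intf; rewrite (funext (selectionE c f)).
by apply: integrable_sum => // i _; exact: integrable_restrict.
Qed.

(** Cutting along the values of [c] leaves fixed indices only, for which the conditional
    expectations are given. *)
Lemma integral_selection (I : finType) (c : T -> I) (f : I -> T -> \bar R)
    (A : set T) :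
  (forall i, measurable (c @^-1` [set i])) -> measurable A ->
  (forall i, P.-integrable setT (f i)) ->
  (\int[P]_(w in A) f (c w) w =
   \sum_(i : I) \int[P]_(w in A `&` c @^-1` [set i]) f i w)%E.
Proof.
move=> mc mA intf; under eq_integral do rewrite selectionE.
rewrite integral_sum//; last first.
  move=> i; apply: (@integrableS _ _ _ P setT) => //.
  exact: integrable_restrict.
by apply: eq_bigr => i _; rewrite integral_mkcondr.
Qed.

Lemma integral_affine (a b : R) (f : T -> R) (A : set T) :
  measurable A -> P.-integrable setT (EFin \o f) ->
  (\int[P]_(w in A) (a * f w + b)%:E =
   a%:E * \int[P]_(w in A) (f w)%:E + b%:E * P A)%E.
Proof.
move=> mA intf; have intA : P.-integrable A (EFin \o f).
  exact: (@integrableS _ _ _ P setT).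
under eq_integral do rewrite EFinD EFinM.
rewrite integralD//; last 2 first.
- exact: integrableZl.
- exact: finite_measure_integrable_cst.
by rewrite integralZl// integral_cst.
Qed.

End selection.

(** * Countable families of almost sure events, and the conditional Jensen inequality *)

Lemma ae_forall_countable d (T : measurableType d) (R : realType)
    (P : {measure set T -> \bar R}) (J : countType) (Q : J -> T -> Prop) :
  (forall j, {ae P, forall w, Q j w}) -> {ae P, forall w, forall j, Q j w}.
Proof.
move=> aeQ.
(* Naturals that decode to no index carry the trivial property. *)
have : {ae P, forall w, forall n,
    if unpickle n is Some j then Q j w else True}.
  apply: ae_foralln => n; case: (unpickle n) => [j|]; first exact: aeQ.
  exact: aeW.
by apply: filterS => w Qw j; have := Qw (pickle j); rewrite pickleK.
Qed.

Unset Implicit Arguments.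

Theorem lemma4p6 (R : realType) (disp : measure_display)
  (T : measurableType disp) (P : probability T R) (d k : nat)
  (* the random pair and the predictor *)
  (X : T -> borel_rV R d) (Y : T -> 'I_k) (g : borel_rV R d -> borel_rV R k)
  (mX : measurable_fun [set: T] X)
  (mY : forall i : 'I_k, measurable (Y @^-1` [set i]))
  (mg : measurable_fun [set: borel_rV R d] g)
  (g_simplex : forall x, simplex (g x : 'rV[R]_k))
  (* the tie-breaking rule, so that c(X) = am (g X) *)
  (am : 'rV[R]_k -> 'I_k) (amP : is_argmax_rule am)
  (phi : 'rV[R]_k -> \bar R) (grad_phi : 'rV[R]_k -> 'I_k -> \bar R)
  (varphi varphi' : R^o -> \bar R)
  (phi_C1 : C1_on_simplex phi grad_phi)
  (phi_convex : econvex_on (@simplex R k) phi)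
  (varphi_C1 : C1_on_unit_itv varphi varphi')
  (varphi_convex : econvex_on (@unit_itv R) varphi)
  (dominated : forall x y : 'rV[R]_k, simplex x -> simplex y ->
     forall i : 'I_k,
       (bregman_unit_itv varphi varphi' (x ord0 i) (y ord0 i)
          <= bregman_simplex phi grad_phi x y)%E)
  (* pi_{Y|X}, as a random vector of the simplex *)
  (piYX : T -> 'rV[R]_k)
  (piYX_simplex : forall w, simplex (piYX w))
  (piYXP : forall i : 'I_k,
     is_condexp P (fun w => (\1_(Y @^-1` [set i]) w)%:E) X
       (fun w => (piYX w ord0 i)%:E))
  (* E[pi_{Y|X} | g(X)] *)
  (p : T -> 'rV[R]_k)
  (pP : forall i : 'I_k,
     is_condexp P (fun w => (piYX w ord0 i)%:E) (g \o X)
       (fun w => (p w ord0 i)%:E))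
  (* E[1_{Y = c(X)} | h(X)] *)
  (q : T -> R)
  (qP : is_condexp P (fun w => (\1_[set w' | Y w' = am (g (X w'))] w)%:E)
          (fun w => max_coord (g (X w) : 'rV[R]_k))
          (fun w => (q w)%:E))
  (* E[d_phi(E[pi_{Y|X} | g(X)], g(X)) | h(X)] *)
  (D : T -> \bar R)
  (DP : is_condexp P (fun w => bregman_simplex phi grad_phi (p w) (g (X w)))
          (fun w => max_coord (g (X w) : 'rV[R]_k)) D) :
  {ae P, forall w,
     (bregman_unit_itv varphi varphi' (q w) (max_coord (g (X w) : 'rV[R]_k))
        <= D w)%E}.
Proof.
pose Z w := g (X w).
pose h w := max_coord (Z w : 'rV[R]_k).
pose c w := am (Z w).
have mZ : measurable_fun setT Z by exact: measurableT_comp.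
have mh : measurable_fun setT h.
  exact: measurableT_comp (@measurable_max_coord R k) mZ.
(* The tie-breaking rule is measurable only on the simplex, where [g] takes its values. *)
have sc i : g_sigma_algebra_preimage Z (c @^-1` [set i]).
  exists (@simplex R k `&` am @^-1` [set i]); first exact: amP.2.
  rewrite setTI; apply/seteqP; split => w; first by case.
  by move=> cw; split => //; exact: g_simplex.
have mc i : measurable (c @^-1` [set i]).
  exact: g_sigma_algebra_preimage_measurable mZ (sc i).
have mind (B : set T) : measurable B ->
    P.-integrable setT (fun w => (\1_B w)%:E : \bar R).
  by move=> mB; apply: integrable_indic => //; rewrite ?ltry.
have ind01 (B : set T) w : (0 <= (\1_B w : R)%:E <= 1)%E.
  by rewrite indicE !lee_fin ler0n lern1 leq_b1.
have YcE w : (\1_[set w' | Y w' = am (g (X w'))] w)%:E =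
    (\1_(Y @^-1` [set c w]) w)%:E :> \bar R.
  by rewrite !indicE; congr (_%:R)%:E; congr nat_of_bool;
     apply/idP/idP => /set_mem/= H; apply/mem_set.
have intp i : P.-integrable setT (fun w => (p w ord0 i)%:E).
  apply: condexp_integrable (pP i) => // w; rewrite !lee_fin.
  exact: simplex_coord_itv.
have intq : P.-integrable setT (EFin \o q).
  by apply: condexp_integrable qP => // w.
pose pc w := p w ord0 (c w).
have intpc : P.-integrable setT (EFin \o pc).
  exact: (integrable_selection (f := fun i w => (p w ord0 i)%:E)) mc intp.
(* Tower property: the sigma-algebras of [h], [Z] and [X] increase and [c] is a function of [Z], so
   on each piece where [c] is constant both sides reduce to the integral of the indicator of
   [Y = i]. *)
have q_pc A : g_sigma_algebra_preimage h A ->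
    (\int[P]_(w in A) (q w)%:E = \int[P]_(w in A) (pc w)%:E)%E.
  move=> sA; have mA := g_sigma_algebra_preimage_measurable mh sA.
  have sAZ : g_sigma_algebra_preimage Z A.
    exact: g_sigma_algebra_preimage_comp (@measurable_max_coord R k) sA.
  rewrite (proj2 qP)//; under eq_integral do rewrite YcE.
  rewrite (integral_selection
    (f := fun i w => (\1_(Y @^-1` [set i]) w)%:E : \bar R) mc mA) => [|i]; last first.
    exact: mind.
  rewrite (integral_selection (f := fun i w => (p w ord0 i)%:E) mc mA intp).
  apply: eq_bigr => i _.
  have sAi : g_sigma_algebra_preimage Z (A `&` c @^-1` [set i]).
    exact: g_sigma_algebra_preimageI.
  rewrite (proj2 (pP i))// (proj2 (piYXP i))//.
  exact: (g_sigma_algebra_preimage_comp mg).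
have h_pc w : simplex (p w) ->
    (bregman_unit_itv varphi varphi' (pc w) (h w)
     <= bregman_simplex phi grad_phi (p w) (g (X w)))%E.
  move=> pw; rewrite /h (max_coord_argmax amP (g_simplex _)).
  exact: dominated.
pose B (j : rat * rat * rat * rat) w := let: (a, b, r, r') := j in
  [/\ ratr r < ratr r' :> R, (D w <= (ratr r)%:E)%E,
      ratr r' <= ratr a * q w + ratr b &
      forall x, @unit_itv R x -> ((ratr a * x + ratr b)%:E <=
        bregman_unit_itv varphi varphi' x (h w))%E].
suff : {ae P, forall w, forall j, ~ B j w}.
  apply: filterS => w nB; rewrite leNgt; apply/negP => Dw.
  have [a [b [r [r' H]]]] := bregman_rational_line varphi_C1 varphi_convex Dw.
  exact: (nB (a, b, r, r')).
apply: ae_forall_countable => -[[[a b] r] r'].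
have [rr'|nrr'] := boolP (ratr r < ratr r' :> R); last first.
  by apply: aeW => w [rr']; rewrite rr' in nrr'.
have h_itv w : @unit_itv R (h w).
  apply/unit_itvP; rewrite /h (max_coord_argmax amP (g_simplex _)).
  by apply: simplex_coord_itv; exact: g_simplex.
pose S := [set y : R | @unit_itv R y /\
  forall x, @unit_itv R x ->
    ((ratr a * x + ratr b)%:E <= bregman_unit_itv varphi varphi' x y)%E].
(* The event [B] is split into conditions on [h], [D] and [q] separately, each in the sigma-algebra
   of [h]. *)
pose A := h @^-1` S `&` (D @^-1` [set x | (x <= (ratr r)%:E)%E] `&`
  (EFin \o q) @^-1` (EFin @` [set x : R | ratr r' <= ratr a * x + ratr b])).
have sA : g_sigma_algebra_preimage h A.
  apply: g_sigma_algebra_preimageI; last apply: g_sigma_algebra_preimageI.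
  - exists S; last by rewrite setTI.
    exact: measurable_line_below_bregman.
  - apply: (proj1 DP).
    rewrite (_ : [set x | _] = `]-oo, (ratr r)%:E]%classic); last first.
      by rewrite set_itvE.
    exact: emeasurable_itv.
  - apply: (proj1 qP); apply: measurable_image_EFin.
    rewrite (_ : [set x | _] =
        setT `&` (fun x : R => ratr a * x + ratr b) @^-1` `[ratr r', +oo[); last first.
      by rewrite setTI; apply/seteqP; split => x /=; rewrite in_itv/= andbT.
    apply: continuous_measurable_fun => // x.
    apply: cvgD; last exact: cvg_cst.
    by apply: cvgMl_tmp; exact: cvg_id.
have mA := g_sigma_algebra_preimage_measurable mh sA.
exists A; split => //; last first.
  move=> w /= /contrapT[_ Dr r'q line].
  split; [by split|split => //].
  by exists (q w).
have ge_r' : ((ratr r')%:E * P A <= \int[P]_(w in A) D w)%E.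
  rewrite (proj2 DP)// -integral_cst//.
  apply: (@le_trans _ _ (\int[P]_(w in A) (ratr a * q w + ratr b)%:E)%E).
    by apply: integral_le_pointwise => w [_ [_ [x /= xr' [<-]]]]; rewrite lee_fin.
  rewrite integral_affine// q_pc// -integral_affine//.
  apply: integral_le_pointwise => w [[_ line] _].
  (* A version [p] may leave the simplex at some [w]; the divergence is then [+oo] by convention and
     the bound is trivial. *)
  have [pw|npw] := pselect (simplex (p w)); last first.
    rewrite /bregman_simplex /bregman asboolF; first exact: leey.
    by case.
  apply: le_trans (h_pc _ pw); apply: line; apply/unit_itvP.
  exact: simplex_coord_itv.
have le_r : (\int[P]_(w in A) D w <= (ratr r)%:E * P A)%E.
  rewrite -integral_cst//.
  by apply: integral_le_pointwise => w [_ []].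
have finPA : P A \is a fin_num by exact: fin_num_measure.
have PA0 : 0 <= fine (P A) by rewrite fine_ge0.
have := le_trans ge_r' le_r.
rewrite -(fineK finPA) -!EFinM lee_fin => le_rr'.
suff PA : P A = 0%E by exact: PA.
rewrite -(fineK finPA); congr (_%:E).
apply/eqP; rewrite eq_le PA0 andbT leNgt; apply/negP => PA.
by move: le_rr'; rewrite ler_pM2r// leNgt rr'.
Qed.
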